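(* Let $N$ and $n$ be integers with $2\leqslant n<N$, and let $a=(a_1,\dots,a_N)$, $b=(b_1,\dots,b_N)$ be real numbers with $a_i>0$ and $b_i>0$ for all $i$. For a set $I\subseteq\{1,\dots,N\}$ write $R(I)=\frac{\sum_{i\in I}a_i}{\sum_{i\in I}b_i}$. Let $I_n=\{i_1,\dots,i_n\}$ be any output of the greedy algorithm described in the context (with any choice of tie-breaking), and let $J_n=\{j_1,\dots,j_n\}$ be any set of $n$ distinct indices in $\{1,\dots,N\}$ that minimizes $R$ among all $n$-element subsets of $\{1,\dots,N\}$. Then: (1) If the equalities $\frac{a_{j_1}}{b_{j_1}}=\frac{a_{j_2}}{b_{j_2}}=\dots=\frac{a_{j_n}}{b_{j_n}}$ do not all hold, then $I_n\cap J_n\neq\varnothing$. (2) If all of these equalities hold, then the greedy algorithm is exact, i.e. $I_n$ is a minimizing index set: $R(I_n)=R(J_n)=\min\{R(I): I\subseteq\{1,\dots,N\},\ |I|=n\}$.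
   Context: Greedy algorithm: given the positive arrays $a,b$ and $n<N$, first choose $i_1\in\arg\min_{1\leqslant k\leqslant N} a_k/b_k$ and set $I=\{i_1\}$. Then for $m=2,\dots,n$, choose $i_m\in\arg\min_{k\in\{1,\dots,N\}\setminus\{i_1,\dots,i_{m-1}\}}\frac{a_{i_1}+\dots+a_{i_{m-1}}+a_k}{b_{i_1}+\dots+b_{i_{m-1}}+b_k}$ and set $I:=I\cup\{i_m\}$. The output is $I_n=\{i_1,\dots,i_n\}$. When an argmin is not unique, any minimizer may be chosen. *)

(* Defs.v *)
From mathcomp Require Import all_boot all_order all_algebra.
From mathcomp Require Import reals.

Set Implicit Arguments.
Unset Strict Implicit.
Unset Printing Implicit Defensive.

Import Order.TTheory GRing.Theory Num.Theory.
Local Open Scope ring_scope.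

Definition is_argmin (R : realType) (T : finType) (D : {set T}) (f : T -> R)
    (k : T) : Prop :=
  k \in D /\ forall l, l \in D -> f k <= f l.

Definition sum_ratio (R : realType) (N : nat) (a b : 'I_N -> R)
    (I : {set 'I_N}) : R :=
  (\sum_(i in I) a i) / (\sum_(i in I) b i).

(* [greedy_run a b s]: s = [:: i_1; ...; i_m] lists, in order of selection, the
   indices picked in the first m >= 1 steps.  Ties are broken arbitrarily, hence
   a relation rather than a function. *)
Inductive greedy_run (R : realType) (N : nat) (a b : 'I_N -> R) :
    seq 'I_N -> Prop :=
| greedy_first (k : 'I_N) :
    is_argmin [set: 'I_N] (fun l => a l / b l) k ->
    greedy_run a b [:: k]
| greedy_next (s : seq 'I_N) (k : 'I_N) :
    greedy_run a b s ->
    is_argmin [set l | l \notin s]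
      (fun l => (\sum_(i <- s) a i + a l) / (\sum_(i <- s) b i + b l)) k ->
    greedy_run a b (rcons s k).

Definition greedy_output (R : realType) (N : nat) (a b : 'I_N -> R) (n : nat)
    (I : {set 'I_N}) : Prop :=
  exists s : seq 'I_N, [/\ greedy_run a b s, size s = n & I = [set i in s]].

Definition minimizing_set (R : realType) (N : nat) (a b : 'I_N -> R) (n : nat)
    (J : {set 'I_N}) : Prop :=
  is_argmin [set K : {set 'I_N} | #|K| == n] (sum_ratio a b) J.

Definition equal_ratios (R : realType) (N : nat) (a b : 'I_N -> R)
    (J : {set 'I_N}) : Prop :=
  forall j k, j \in J -> k \in J -> a j / b j = a k / b k.

(* Main.v *)
Require Import Defs.
From mathcomp Require Import all_boot all_order all_algebra.
From mathcomp Require Import reals.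

(** Put [r := R(J_n)], so that the excesses [a j - r b j] sum to [0] over [J_n].
    If at each step some index of nonpositive excess is still available, the
    greedy choice keeps the total excess of the selected set nonpositive, and
    negative once the first choice has negative excess.  When the ratios on
    [J_n] are all equal, every index of [J_n] has excess [0], and fewer than [n]
    selections cannot exhaust [J_n]; hence [R(I_n) <= r].  When they are not all
    equal, some index of [J_n] has negative excess; were [I_n] disjoint from
    [J_n], that index would remain available throughout and [R(I_n) < r] would
    contradict the minimality of [J_n]. *)

Set Implicit Arguments.
Unset Strict Implicit.
Unset Printing Implicit Defensive.

Import Order.TTheory GRing.Theory Num.Theory.
Local Open Scope ring_scope.

Lemma greedy_run_uniq (R : realType) (N : nat) (a b : 'I_N -> R) (s : seq 'I_N) :
  greedy_run a b s -> uniq s.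
Proof.
elim=> // {}s k _ us [+ _].
by rewrite inE rcons_uniq => ->.
Qed.

(** The flag [c] treats both bounds at once: [true] is [<=], [false] is [<]. Availability ranges
    over all shorter [t] with entries in [s], so it restricts to the initial run in the
    induction. *)
Lemma greedy_run_sum_lteif (R : realType) (N : nat) (a b : 'I_N -> R) (r : R)
    (c : bool) (j0 : 'I_N) (s : seq 'I_N) :
  (forall i, 0 < b i) ->
  a j0 < r * b j0 ?<= if c ->
  greedy_run a b s ->
  (forall t, {subset t <= s} -> (size t < size s)%N ->
     exists2 j, j \notin t & a j <= r * b j) ->
  \sum_(i <- s) a i < r * \sum_(i <- s) b i ?<= if c.
Proof.
move=> b0 aj0; elim=> [k [_ kmin] _|{}s k _ IH [_ kmin] avail].
  rewrite !big_seq1 -lteif_pdivrMr //.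
  by apply: (lteif_trans (y := a j0 / b j0) (C1 := true));
    [exact: kmin|rewrite lteif_pdivrMr].
have /IH {}IH t : {subset t <= s} -> (size t < size s)%N ->
    exists2 j, j \notin t & a j <= r * b j.
  move=> ts lt_ts; apply: avail.
    by move=> x /ts xs; rewrite mem_rcons inE xs orbT.
  by rewrite size_rcons ltnS ltnW.
have [||j js aj] := avail s.
- by move=> x xs; rewrite mem_rcons inE xs orbT.
- by rewrite size_rcons.
have B0 l : 0 < \sum_(i <- s) b i + b l.
  by rewrite ltr_wpDl // sumr_ge0 // => i _; exact: ltW.
rewrite -!cats1 !big_cat !big_seq1 /= -lteif_pdivrMr //.
(* It suffices to bound the ratio with [j] in place of [k]; strictness then comes from the induction
   hypothesis alone. *)
apply: (lteif_trans (C1 := true)) (kmin j _) _; first by rewrite inE.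
rewrite lteif_pdivrMr // mulrDr.
by case: c IH {aj0} => /= IH; [exact: lerD|exact: ltr_leD].
Qed.

Theorem theorem1 (R : realType) (N n : nat) (a b : 'I_N -> R)
    (I_n J_n : {set 'I_N}) :
  (2 <= n)%N -> (n < N)%N ->
  (forall i, 0 < a i) -> (forall i, 0 < b i) ->
  greedy_output a b n I_n ->
  minimizing_set a b n J_n ->
  (~ equal_ratios a b J_n -> I_n :&: J_n <> set0) /\
  (equal_ratios a b J_n ->
     minimizing_set a b n I_n /\ sum_ratio a b I_n = sum_ratio a b J_n).
Proof.
move=> n2 nN a0 b0 [s [gs szs ->]] [].
rewrite inE => /eqP cJ Jmin; set r := sum_ratio a b J_n.
have us := greedy_run_uniq gs.
have cI : #|[set i in s]| = n by rewrite cardsE (card_uniqP us).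
have sumI (f : 'I_N -> R) : \sum_(i in [set i in s]) f i = \sum_(i <- s) f i.
  by rewrite big_uniq //=; apply: eq_bigl => i; rewrite inE.
have sum_b_gt0 (K : {set 'I_N}) : #|K| = n -> 0 < \sum_(i in K) b i.
  move=> cK; have /card_gt0P[i iK] : (0 < #|K|)%N by rewrite cK ltnW.
  rewrite (bigD1 i) //= ltr_pwDl // sumr_ge0 // => k _; exact: ltW.
have ratioI c : (sum_ratio a b [set i in s] < r ?<= if c)
    = (\sum_(i <- s) a i < r * \sum_(i <- s) b i ?<= if c).
  by rewrite /sum_ratio lteif_pdivrMr ?sumI // -sumI sum_b_gt0.
have sumJ : \sum_(i in J_n) (a i - r * b i) = 0.
  by rewrite sumrB -mulr_sumr /r /sum_ratio divfK ?subrr // gt_eqF ?sum_b_gt0.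
have rle : r <= sum_ratio a b [set i in s] by apply: Jmin; rewrite inE cI.
split=> [neqJ IJ0|eqJ].
  (* Without a negative excess in [J_n], nonnegative terms sum to zero, so all vanish and every
     ratio is [r]. *)
  have [/existsP[j /andP[jJ ajlt]]|/existsPn noj] :=
    boolP [exists j, (j \in J_n) && (a j < r * b j)]; last first.
    apply: neqJ; suff ratioJ i : i \in J_n -> a i / b i = r.
      by move=> i k iJ kJ; rewrite !ratioJ.
    have le0 k : k \in J_n -> 0 <= a k - r * b k.
      by move=> kJ; move: (noj k); rewrite kJ /= -leNgt subr_ge0.
    move=> iJ; move/eqP: sumJ; rewrite psumr_eq0 // => /allP/(_ i (mem_index_enum i)).
    by rewrite iJ /= subr_eq0 => /eqP ->; rewrite mulfK // gt_eqF.
  suff : sum_ratio a b [set i in s] < r ?<= if false by rewrite /= ltNge rle.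
  (* [j] is both the rival of the first choice, giving strictness, and the index available at every
     later step. *)
  rewrite ratioI; apply: (greedy_run_sum_lteif b0 _ gs (j0 := j)) => // t ts _.
  exists j; last exact: ltW.
  apply/negP => /ts js; suff : j \in set0 by rewrite inE.
  by rewrite -IJ0 !inE js.
have aJ j : j \in J_n -> a j = r * b j.
  (* The common ratio factors out of the numerator of [r], so it equals [r]. *)
  move=> jJ; have aE k : k \in J_n -> a k = a j / b j * b k.
    by move=> kJ; rewrite (eqJ j k) // divfK // gt_eqF.
  rewrite /r /sum_ratio (eq_bigr _ aE) -mulr_sumr mulfK ?gt_eqF ?sum_b_gt0 //.
  by rewrite divfK // gt_eqF.
have avail (t : seq 'I_N) : (size t < n)%N -> exists2 j, j \notin t & a j <= r * b j.
  move=> tn; have /subsetPn[j jJ jt] : ~~ (J_n \subset t).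
    apply: contraL tn => /subset_leq_card; rewrite cJ -leqNgt => /leq_trans.
    by apply; exact: card_size.
  by exists j; rewrite ?aJ.
have [j0 _ aj0] := avail [::] (ltnW n2).
have leI : sum_ratio a b [set i in s] <= r.
  rewrite -[_ <= _]/(_ < _ ?<= if true) ratioI.
  apply: (greedy_run_sum_lteif (c := true) b0 aj0 gs) => t _; rewrite szs; exact: avail.
split; last by apply/eqP; rewrite eq_le leI.
split=> [|K cK]; first by rewrite inE cI.
exact: le_trans leI (Jmin K cK).
Qed.
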